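(* Suppose $f\in L^2(\mathbb{C},\mathrm{e}^{|z|^2})$, and that $u$ solves the equation $\bar\partial u=f$ on $\mathbb{C}$ while $u\in L^2(\mathbb{C},\mathrm{e}^{\epsilon|z|^2})$ for some positive real $\epsilon$. Then $$\int_{\mathbb{C}} z^j f(z)\,\mathrm{d}A(z)=0,\qquad j=0,1,2,\ldots.$$
   Context: Write $z=x+\mathrm{i}y\in\mathbb{C}$. $\mathrm{d}A(z)=\mathrm{d}x\,\mathrm{d}y$ is area measure and $\bar\partial=\frac12\left(\frac{\partial}{\partial x}+\mathrm{i}\frac{\partial}{\partial y}\right)$. For a positive weight $\omega$ on $\mathbb{C}$, $L^2(\mathbb{C},\omega)$ is the space of (complex-valued, measurable, modulo a.e. equality) functions $g$ on $\mathbb{C}$ with $\int_{\mathbb{C}}|g|^2\omega\,\mathrm{d}A<+\infty$. The equation $\bar\partial u=f$ is understood in the sense of distributions on $\mathbb{C}$. *)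

(* Defs.v *)
From HB Require Import structures.
From mathcomp Require Import all_boot all_order all_algebra.
From mathcomp Require Import all_classical all_reals all_analysis.
From mathcomp Require Export complex.

Set Implicit Arguments.
Unset Strict Implicit.
Unset Printing Implicit Defensive.

Import Order.TTheory GRing.Theory Num.Theory.
Import numFieldNormedType.Exports.

Local Open Scope classical_set_scope.
Local Open Scope ring_scope.
Local Open Scope complex_scope.

Section ComplexPlane.
Variable R : realType.

(* [R[i]] carries neither a sigma-algebra nor an [R]-normed topology in the
   libraries; both are taken from the real plane through [z = x + i y]. *)
Definition toC (p : R * R) : R[i] := p.1 +i* p.2.
Definition ofC (z : R[i]) : R * R := (complex.Re z, complex.Im z).

Definition rePart (g : R[i] -> R[i]) : R * R -> R :=
  fun p => complex.Re (g (toC p)).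
Definition imPart (g : R[i] -> R[i]) : R * R -> R :=
  fun p => complex.Im (g (toC p)).

Definition dA : {measure set (measurableTypeR R * measurableTypeR R) -> \bar R} :=
  (@lebesgue_measure R \x @lebesgue_measure R)%E.

Definition cmeasurable (g : R[i] -> R[i]) : Prop :=
  measurable_fun [set: measurableTypeR R * measurableTypeR R] (rePart g) /\
  measurable_fun [set: measurableTypeR R * measurableTypeR R] (imPart g).

Definition cintegrable (g : R[i] -> R[i]) : Prop :=
  dA.-integrable setT (EFin \o rePart g) /\
  dA.-integrable setT (EFin \o imPart g).

(* A junk value when [g] is not [cintegrable]. *)
Definition cintegral (g : R[i] -> R[i]) : R[i] :=
  (\int[dA]_p rePart g p)%R +i* (\int[dA]_p imPart g p)%R.

(* Membership in the weighted space is stated for representatives. *)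
Definition L2w (w : R[i] -> R) (g : R[i] -> R[i]) : Prop :=
  cmeasurable g /\
  (\int[dA]_p (Normc.normc (g (toC p)) ^+ 2 * w (toC p))%:E < +oo)%E.

Definition e_x : R * R := (1, 0).
Definition e_y : R * R := (0, 1).

(* All partial derivatives of order at most [k] exist and are continuous. *)
Fixpoint Ck (k : nat) (h : R * R -> R) : Prop :=
  continuous h /\
  if k is k'.+1 then
    [/\ forall p, derivable h p e_x, forall p, derivable h p e_y,
        Ck k' (fun p => 'D_(e_x) h p) & Ck k' (fun p => 'D_(e_y) h p)]
  else True.

Definition smooth (h : R * R -> R) : Prop := forall k, Ck k h.

Definition test_function (phi : R[i] -> R[i]) : Prop :=
  [/\ smooth (rePart phi), smooth (imPart phi) &
      compact (closure [set p : R * R | phi (toC p) != 0])].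

Definition pderiv (v : R * R) (g : R[i] -> R[i]) (z : R[i]) : R[i] :=
  ('D_v (rePart g) (ofC z)) +i* ('D_v (imPart g) (ofC z)).

Definition dbar (g : R[i] -> R[i]) (z : R[i]) : R[i] :=
  2^-1 * (pderiv e_x g z + (0 +i* 1) * pderiv e_y g z).

(* [dbar u = f] in the sense of distributions, for locally integrable [u] and
   [f], in particular for members of [L2w w] with [w] continuous and positive,
   for which the integrands below are integrable. *)
Definition weak_dbar (u f : R[i] -> R[i]) : Prop :=
  forall phi, test_function phi ->
    - cintegral (fun z => u z * dbar phi z) = cintegral (fun z => f z * phi z).

End ComplexPlane.

(* Main.v *)
(** Test the equation against [phi_c = z^j chi (1 - c |z|^2)], where
    [chi t = exp (-1/t)] for [t > 0] and [0] otherwise.  Since [dbar] is a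
    derivation killing [z], [dbar phi_c = - c z^(j+1) chi' (1 - c |z|^2)], so
      [c \int u z^(j+1) chi' (1 - c |z|^2) = \int f z^j chi (1 - c |z|^2)].
    The Gaussian weights make [z^j f] and [z^(j+1) u] integrable, and [chi],
    [chi'] are bounded; as [c -> 0] the left side tends to [0] and the right
    side to [exp (-1) \int f z^j]. *)

Require Import Defs.
From mathcomp Require Import all_boot all_order all_algebra.
From mathcomp Require Import all_classical all_reals all_analysis.
From mathcomp Require Import measurable_realfun complex ring lra.

Set Implicit Arguments.
Unset Strict Implicit.
Unset Printing Implicit Defensive.

Import Order.TTheory GRing.Theory Num.Theory.
Import numFieldNormedType.Exports.

Local Open Scope classical_set_scope.
Local Open Scope ring_scope.
Local Open Scope complex_scope.

(** * Functions flat at the origin: $t^{-k} e^{-1/t}$ extended by zero *)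

Section Flat.
Variable R : realType.
Implicit Types (t x : R) (k : nat).

(** One term of the exponential series is at most the sum. The bound serves twice: it bounds the
    functions [flat k], and it absorbs powers of $|z|$ into a Gaussian. *)
Lemma exprn_le_expR k x : 0 <= x -> x ^+ k <= k`!%:R * expR x.
Proof.
move=> x0; case: k => [|k].
  by rewrite expr0 fact0 mul1r (le_trans _ (expR_ge1Dx x))// lerDl.
have := expR_ge1Dxn k x0; have f0 : 0 < (k.+1`!)%:R :> R by rewrite ltr0n fact_gt0.
move=> h; rewrite mulrC -ler_pdivrMr//; apply: le_trans h; rewrite lerDr//.
Qed.

(* The powers of [t] make the span of the family stable under differentiation. *)
Definition flat k t : R := if 0 < t then t ^- k * expR (- t^-1) else 0.

Lemma flat_ge0 k t : 0 <= flat k t.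
Proof.
rewrite /flat; case: ifP => // t0.
by rewrite mulr_ge0 ?expR_ge0// invr_ge0 exprn_ge0// ltW.
Qed.

(** For $t > 0$, substitute $s = 1/t$: the claim becomes $s^k \le k!\, e^s$. *)
Lemma flat_le k t : flat k t <= k`!%:R.
Proof.
rewrite /flat; case: ifP => t0; last by rewrite ler0n.
rewrite -exprVn expRN ler_pdivrMr ?expR_gt0//.
by apply: exprn_le_expR; rewrite invr_ge0 ltW.
Qed.

Lemma flat_norm_le k t : `|flat k t| <= k`!%:R.
Proof. by rewrite ger0_norm ?flat_ge0 ?flat_le. Qed.

(** Valid for $t \le 0$ too, where both sides vanish. It extracts powers of $t$ from the difference
    quotient at the origin. *)
Lemma flatS k t : flat k t = t * flat k.+1 t.
Proof.
rewrite /flat; case: ifP => t0; last by rewrite mulr0.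
by rewrite mulrA exprS invfM mulrA divff ?mul1r// gt_eqF.
Qed.

Let is_derive_flat_gt0 k t : 0 < t ->
  is_derive t 1 (flat k) (flat k.+2 t - k%:R * flat k.+1 t).
Proof.
move=> t0.
apply: (@near_eq_is_derive _ _ _ (fun t => t ^- k * expR (- t^-1))).
  by near=> x; rewrite /flat ifT//; near: x; exact: lt_nbhsr.
have tN0 : t != 0 by rewrite gt_eqF.
have dV : is_derive t 1 (fun x : R => x^-1) (- t ^- 2).
  apply: DeriveDef; first by apply: derivableV => //; exact: derivable_id.
  by rewrite deriveV// ?derive_id ?scaler1//; exact: derivable_id.
have dE : is_derive t 1 (fun x : R => expR (- x^-1)) (t ^- 2 * expR (- t^-1)).
  have := @is_derive1_comp _ expR (fun x : R => - x^-1) t _ _ (is_derive_expR _) (is_deriveN dV).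
  by rewrite opprK mulrC.
have dX : is_derive t 1 (fun x : R => x ^- k) (- (k%:R * t ^- k.+1)).
  have -> : (fun x : R => x ^- k) = (fun x => x^-1) ^+ k.
    by apply/funext => x; rewrite exprfctE exprVn.
  apply: (is_derive_eq (is_deriveX k dV)).
  rewrite /GRing.scale /=; case: k => [|k]; first by rewrite !mul0r oppr0.
  rewrite mulrN -mulrA; congr (- (_ * _)).
  by rewrite exprVn -invfM -exprD /= addn2.
apply: (is_derive_eq (is_deriveM dX dE)).
rewrite /flat !ifT// /GRing.scale /= mulrA -invfM -exprD addn2; ring.
Unshelve. all: by end_near. Qed.

Let is_derive_flat_lt0 k t : t < 0 ->
  is_derive t 1 (flat k) (flat k.+2 t - k%:R * flat k.+1 t).
Proof.
move=> t0.
apply: (@near_eq_is_derive _ _ _ (cst 0)).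
  near=> x; rewrite /flat ifF//; apply/negbTE; rewrite -leNgt ltW//.
  by near: x; exact: lt_nbhsl.
have f0 m : flat m t = 0 by rewrite /flat ltNge (ltW t0).
by rewrite !f0 mulr0 subr0; exact: is_derive_cst.
Unshelve. all: by end_near. Qed.

Let is_derive_flat0 k : is_derive (0 : R) 1 (flat k) 0.
Proof.
have f0 : flat k 0 = 0 by rewrite /flat ltxx.
have lim0 : (fun h : R => h^-1 *: ((flat k \o shift 0) (h *: 1) - flat k 0)) @ 0^' --> (0 : R).
  rewrite f0; apply: cvg_within_filter.
  have M0 : 0 < (k.+2)`!%:R :> R by rewrite ltr0n fact_gt0.
  apply/cvgrPdist_le => /= e e0.
  near=> h.
  rewrite subr0 addr0 [_ *: 1]mulr1 sub0r normrN /GRing.scale /=.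
  (* Now [flat k h] is $h^2$ times [flat k.+2 h], so the quotient is $h$ times a function bounded by
     $(k+2)!$. The neighbourhood is no longer punctured, so $h = 0$ is treated separately; the
     quotient is zero there. *)
  rewrite flatS flatS.
  have [->|h0] := eqVneq h 0; first by rewrite mul0r mulr0 normr0 ltW.
  rewrite mulKf// normrM.
  apply: (@le_trans _ _ (`|h| * (k.+2)`!%:R)).
    by rewrite ler_wpM2l// ger0_norm ?flat_ge0 ?flat_le.
  rewrite -ler_pdivlMr//; near: h.
  have : (fun h : R => h) @ (0 : R) --> (0 : R) by exact: cvg_id.
  move=> /cvgrPdist_le/(_ (e / (k.+2)`!%:R)); rewrite divr_gt0// => /(_ isT).
  by apply: filterS => h; rewrite sub0r normrN.
apply: DeriveDef; first by apply/cvg_ex; exists 0.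
exact: cvg_lim lim0.
Unshelve. all: by end_near. Qed.

(** The right-hand side vanishes for $t \le 0$, so the formula computed for $t > 0$ covers all three
    cases. *)
Lemma is_derive_flat k t :
  is_derive t 1 (flat k) (flat k.+2 t - k%:R * flat k.+1 t).
Proof.
have [t0|t0|->] := ltgtP t 0; [exact: is_derive_flat_lt0|exact: is_derive_flat_gt0|].
by rewrite /flat ltxx mulr0 subr0; exact: is_derive_flat0.
Qed.

Lemma continuous_flat k : continuous (flat k).
Proof.
move=> t; apply/differentiable_continuous/derivable1_diffP.
by have [] := is_derive_flat k t.
Qed.

End Flat.

(** * Directional derivatives and $C^k$ functions on the plane *)

Lemma is_derive_outer_comp (R : realType) (V : normedModType R) (g : R -> R)
    (h : V -> R) (p v : V) (dg dh : R) :
  is_derive (h p) 1 g dg -> is_derive p v h dh ->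
  is_derive p v (g \o h) (dg * dh).
Proof.
move=> Hg [/derivable1P ex_h dhE].
(* A derivative along [v] is an ordinary derivative on the line $t \mapsto t v + p$. The
   one-variable chain rule then suffices, and no total differentiability of [h] is required. *)
have dline (k : V -> R) : 'D_v k p = 'D_1 (fun t : R => k (t *: v + p)) 0.
  rewrite /derive; set a := fun t => t^-1 *: _; set b := fun t => t^-1 *: _.
  suff -> : a = b by [].
  apply/funext => t; rewrite /a /b /=.
  by rewrite addr0 scale0r add0r [t *: 1]mulr1.
have dh1 : is_derive (0 : R) 1 (fun t : R => h (t *: v + p)) dh.
  by apply: DeriveDef => //; rewrite -dline.
have Hg' : is_derive (h ((0 : R) *: v + p)) 1 g dg by rewrite scale0r add0r.
have [ex_gh gh] := is_derive1_comp Hg' dh1.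
by apply: DeriveDef; [exact/derivable1P|rewrite dline].
Qed.

Section Smooth.
Variable R : realType.
Implicit Types (h : R * R -> R) (k : nat) (p v : R * R).

Lemma is_derive_fst p v : is_derive p v (@fst R R) v.1.
Proof.
have lim1 : (fun h : R => h^-1 *: ((fst \o shift p) (h *: v) - fst p)) @ 0^' --> v.1.
  apply: (@cvg_trans _ ((fun _ : R => v.1) @ 0^')); last exact: cvg_cst.
  apply: near_eq_cvg; near=> h.
  rewrite /= addrK scalerA mulVf ?scale1r//.
  by near: h; exact: nbhs_dnbhs_neq.
by apply: DeriveDef; [apply/cvg_ex; exists v.1|exact: cvg_lim lim1].
Unshelve. all: by end_near. Qed.

Lemma is_derive_snd p v : is_derive p v (@snd R R) v.2.
Proof.
have lim1 : (fun h : R => h^-1 *: ((snd \o shift p) (h *: v) - snd p)) @ 0^' --> v.2.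
  apply: (@cvg_trans _ ((fun _ : R => v.2) @ 0^')); last exact: cvg_cst.
  apply: near_eq_cvg; near=> h.
  rewrite /= addrK scalerA mulVf ?scale1r//.
  by near: h; exact: nbhs_dnbhs_neq.
by apply: DeriveDef; [apply/cvg_ex; exists v.2|exact: cvg_lim lim1].
Unshelve. all: by end_near. Qed.

Lemma CkW k h : Ck k.+1 h -> Ck k h.
Proof.
elim: k h => [h []//|k IH h [ch [dx dy Cx Cy]]].
split; first exact: ch.
by split; [exact: dx|exact: dy|exact: IH Cx|exact: IH Cy].
Qed.

Lemma Ck_cst k (a : R) : Ck k (cst a).
Proof.
elim: k a => [a|k IH a]; first by split=> // p; exact: cvg_cst.
split; first by move=> p; exact: cvg_cst.
have E v : (fun p => 'D_v (cst a : R * R -> R) p) = cst 0.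
  by apply/funext => p; exact: derive_cst.
by split; [move=> p; exact: derivable_cst|move=> p; exact: derivable_cst|
  rewrite E; exact: IH|rewrite E; exact: IH].
Qed.

Lemma Ck_fst k : Ck k (@fst R R).
Proof.
case: k => [|k]; first by split=> // p; exact: cvg_fst.
split; first by move=> p; exact: cvg_fst.
have D p v := is_derive_fst p v.
have E v : (fun p => 'D_v (@fst R R) p) = cst v.1.
  by apply/funext => p; case: (D p v).
by split; [move=> p; case: (D p (@e_x R))|move=> p; case: (D p (@e_y R))|
  rewrite E; exact: Ck_cst|rewrite E; exact: Ck_cst].
Qed.

Lemma Ck_snd k : Ck k (@snd R R).
Proof.
case: k => [|k]; first by split=> // p; exact: cvg_snd.
split; first by move=> p; exact: cvg_snd.
have D p v := is_derive_snd p v.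
have E v : (fun p => 'D_v (@snd R R) p) = cst v.2.
  by apply/funext => p; case: (D p v).
by split; [move=> p; case: (D p (@e_x R))|move=> p; case: (D p (@e_y R))|
  rewrite E; exact: Ck_cst|rewrite E; exact: Ck_cst].
Qed.

Lemma CkD k h1 h2 : Ck k h1 -> Ck k h2 -> Ck k (h1 + h2).
Proof.
have cD (f g : R * R -> R) : continuous f -> continuous g -> continuous (f + g).
  by move=> cf cg p; exact: cvgD (cf p) (cg p).
elim: k h1 h2 => [h1 h2 [c1 _] [c2 _]|k IH h1 h2]; first by split=> //; exact: cD.
move=> [c1 [dx1 dy1 Cx1 Cy1]] [c2 [dx2 dy2 Cx2 Cy2]].
split; first exact: cD.
split.
- by move=> p; exact: derivableD.
- by move=> p; exact: derivableD.
- rewrite (_ : (fun p => _) =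
    (fun p => 'D_(@e_x R) h1 p) + (fun p => 'D_(@e_x R) h2 p)); first exact: IH.
  by apply/funext => p; exact: deriveD.
- rewrite (_ : (fun p => _) =
    (fun p => 'D_(@e_y R) h1 p) + (fun p => 'D_(@e_y R) h2 p)); first exact: IH.
  by apply/funext => p; exact: deriveD.
Qed.

Lemma CkM k h1 h2 : Ck k h1 -> Ck k h2 -> Ck k (h1 * h2).
Proof.
have cM (f g : R * R -> R) : continuous f -> continuous g -> continuous (f * g).
  by move=> cf cg p; exact: cvgM (cf p) (cg p).
elim: k h1 h2 => [h1 h2 [c1 _] [c2 _]|k IH h1 h2]; first by split=> //; exact: cM.
(* The Leibniz formula also contains the undifferentiated factors, which must be available at order
   [k] for the induction hypothesis. *)
move=> C1 C2; have C1' := CkW C1; have C2' := CkW C2.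
move: C1 C2 => [c1 [dx1 dy1 Cx1 Cy1]] [c2 [dx2 dy2 Cx2 Cy2]].
split; first exact: cM.
split.
- by move=> p; exact: derivableM.
- by move=> p; exact: derivableM.
- rewrite (_ : (fun p => _) =
    h1 * (fun p => 'D_(@e_x R) h2 p) + h2 * (fun p => 'D_(@e_x R) h1 p)).
    by apply: CkD; exact: IH.
  by apply/funext => p; exact: deriveM.
- rewrite (_ : (fun p => _) =
    h1 * (fun p => 'D_(@e_y R) h2 p) + h2 * (fun p => 'D_(@e_y R) h1 p)).
    by apply: CkD; exact: IH.
  by apply/funext => p; exact: deriveM.
Qed.

Lemma is_derive_flat_comp m h p v : derivable h p v ->
  is_derive p v (flat m \o h)
    ((flat m.+2 (h p) - m%:R * flat m.+1 (h p)) * 'D_v h p).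
Proof.
by move=> dh; apply: is_derive_outer_comp; [exact: is_derive_flat|exact: derivableP].
Qed.

(** Induction on [k] with [m] general: the chain rule raises the index of [flat] by one or two but
    stays in the family, and multiplies by a derivative of [h], which is one order less regular. *)
Lemma Ck_flat_comp k m h : Ck k h -> Ck k (flat m \o h).
Proof.
have cc n (f : R * R -> R) : continuous f -> continuous (flat n \o f).
  by move=> cf p; apply: continuous_comp; [exact: cf|exact: continuous_flat].
elim: k m h => [m h [c _]|k IH m h C]; first by split=> //; exact: cc.
have C' := CkW C; move: C => [c [dx dy Cx Cy]].
have E v : (forall p, derivable h p v) ->
    (fun p => 'D_v (flat m \o h) p) =
    ((flat m.+2 \o h) + cst (- m%:R) * (flat m.+1 \o h)) * (fun p => 'D_v h p).
  move=> d; apply/funext => p; case: (is_derive_flat_comp m (d p)) => _ ->.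
  by rewrite !fctE /= mulNr.
split; first exact: cc.
split.
- by move=> p; case: (is_derive_flat_comp m (dx p)).
- by move=> p; case: (is_derive_flat_comp m (dy p)).
- rewrite (E _ dx); apply: CkM Cx; apply: CkD; first exact: IH.
  by apply: CkM; [exact: Ck_cst|exact: IH].
- rewrite (E _ dy); apply: CkM Cy; apply: CkD; first exact: IH.
  by apply: CkM; [exact: Ck_cst|exact: IH].
Qed.

Lemma smooth_derivable h p : smooth h -> derivable h p (@e_x R) /\ derivable h p (@e_y R).
Proof. by move=> /(_ 1%N) [_ [dx dy _ _]]. Qed.

End Smooth.

(** * Calculus of $\bar\partial$ and the compactly supported test functions *)

Section Dbar.
Variable R : realType.
Implicit Types (g h : R[i] -> R[i]) (p v : R * R) (z : R[i]) (c : R).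

Lemma ofCK : cancel (@ofC R) (@toC R).
Proof. by case. Qed.

Definition csmooth g := smooth (rePart g) /\ smooth (imPart g).

Lemma csmoothM g h : csmooth g -> csmooth h -> csmooth (fun z => g z * h z).
Proof.
move=> [g1 g2] [h1 h2]; split=> k.
(* The difference is written with the constant $-1$, so that closure under sums and products is
   enough. *)
- rewrite (_ : rePart _ = rePart g * rePart h + cst (-1) * (imPart g * imPart h)).
    by apply: CkD; [exact: CkM|apply: CkM; [exact: Ck_cst|exact: CkM]].
  apply/funext => p; rewrite !fctE /rePart /imPart mulN1r.
  by case: (g _) (h _) => a b [a' b'].
- rewrite (_ : imPart _ = rePart g * imPart h + imPart g * rePart h).
    by apply: CkD; exact: CkM.
  apply/funext => p; rewrite !fctE /rePart /imPart.
  by case: (g _) (h _) => a b [a' b'].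
Qed.

Lemma csmooth_id : csmooth id.
Proof. by split=> k; [exact: Ck_fst|exact: Ck_snd]. Qed.

Lemma pderivM v g h z :
  derivable (rePart g) (ofC z) v -> derivable (imPart g) (ofC z) v ->
  derivable (rePart h) (ofC z) v -> derivable (imPart h) (ofC z) v ->
  pderiv v (fun z => g z * h z) z = pderiv v g z * h z + g z * pderiv v h z.
Proof.
move=> dg1 dg2 dh1 dh2; rewrite /pderiv.
rewrite (_ : rePart (fun z => g z * h z) = rePart g * rePart h - imPart g * imPart h); last first.
  apply/funext => p; rewrite !fctE /rePart /imPart.
  by case: (g _) (h _) => a b [a' b'].
rewrite (_ : imPart (fun z => g z * h z) = rePart g * imPart h + imPart g * rePart h); last first.
  apply/funext => p; rewrite !fctE /rePart /imPart.
  by case: (g _) (h _) => a b [a' b'].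
rewrite (deriveB (derivableM dg1 dh1) (derivableM dg2 dh2)).
rewrite (deriveD (derivableM dg1 dh2) (derivableM dg2 dh1)).
rewrite (deriveM dg1 dh1) (deriveM dg2 dh2) (deriveM dg1 dh2) (deriveM dg2 dh1).
have partsE k : k z = rePart k (ofC z) +i* imPart k (ofC z).
  by rewrite /rePart /imPart ofCK; case: (k z).
rewrite (partsE g) (partsE h) /GRing.scale /=.
move: (rePart g _) (imPart g _) (rePart h _) (imPart h _) => a b a' b'.
move: ('D_v _ _) ('D_v _ _) ('D_v _ _) ('D_v _ _) => x y x' y'.
by apply/eqP; rewrite eq_complex /=; apply/andP; split; apply/eqP; ring.
Qed.

Lemma dbarM g h z : csmooth g -> csmooth h ->
  dbar (fun z => g z * h z) z = dbar g z * h z + g z * dbar h z.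
Proof.
move=> [g1 g2] [h1 h2].
have [? ?] := smooth_derivable (ofC z) g1; have [? ?] := smooth_derivable (ofC z) g2.
have [? ?] := smooth_derivable (ofC z) h1; have [? ?] := smooth_derivable (ofC z) h2.
by rewrite /dbar !pderivM//; ring.
Qed.

(** The Cauchy-Riemann equation for $z$: $1 + i \cdot i = 0$. *)
Lemma dbar_id z : dbar id z = 0.
Proof.
rewrite /dbar /pderiv.
have D1 v : 'D_v (rePart (@id R[i])) (ofC z) = v.1 by case: (is_derive_fst (ofC z) v).
have D2 v : 'D_v (imPart (@id R[i])) (ofC z) = v.2 by case: (is_derive_snd (ofC z) v).
rewrite !D1 !D2 /= (_ : _ + _ = 0) ?mulr0//.
by apply/eqP; rewrite eq_complex /=; apply/andP; split; apply/eqP; ring.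
Qed.

(** The explicit [id] displays the factor $z$ as a function, which is the shape the product rules
    expect. *)
Let exprSM h j : (fun z : R[i] => z ^+ j.+1 * h z) = (fun z => id z * (z ^+ j * h z)).
Proof. by apply/funext => z; rewrite exprS mulrA. Qed.

Lemma csmooth_exprM h j : csmooth h -> csmooth (fun z => z ^+ j * h z).
Proof.
move=> hs; elim: j => [|j IH]; last by rewrite exprSM; exact: csmoothM csmooth_id IH.
by under eq_fun do rewrite expr0 mul1r.
Qed.

(** Peel off one factor $z$ at a time: by the product rule each contributes only a term with
    $\bar\partial z = 0$. *)
Lemma dbar_exprM h z j : csmooth h -> dbar (fun z => z ^+ j * h z) z = z ^+ j * dbar h z.
Proof.
move=> hs; elim: j => [|j IH].
  by rewrite expr0 mul1r; under eq_fun do rewrite expr0 mul1r.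
rewrite exprSM (dbarM _ csmooth_id (csmooth_exprM j hs)).
by rewrite dbar_id mul0r add0r IH exprS mulrA.
Qed.

Definition quad c p : R := 1 - c * (p.1 ^+ 2 + p.2 ^+ 2).

(** [flat 0] is the function $\chi$. For $c > 0$ the cutoff vanishes off the open disc of radius
    $c^{-1/2}$. *)
Definition cutoff c z : R[i] := (flat 0 (quad c (ofC z)))%:C.

Let quadE c : quad c = cst 1 + cst (- c) * (@fst R R * @fst R R + @snd R R * @snd R R).
Proof. by apply/funext => p; rewrite !fctE /quad !expr2 mulNr. Qed.

Lemma Ck_quad k c : Ck k (quad c).
Proof.
rewrite quadE; apply: CkD; first exact: Ck_cst.
apply: CkM; first exact: Ck_cst.
by apply: CkD; apply: CkM; (exact: Ck_fst || exact: Ck_snd).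
Qed.

Lemma is_derive_quad c p v :
  is_derive p v (quad c) (- c * 2 * (p.1 * v.1 + p.2 * v.2)).
Proof.
rewrite quadE; have D1 := is_derive_fst p v; have D2 := is_derive_snd p v.
have Dq := is_deriveD (is_deriveM D1 D1) (is_deriveM D2 D2).
apply: (is_derive_eq (is_deriveD (is_derive_cst _ _ _)
  (is_deriveM (is_derive_cst _ _ _) Dq))).
rewrite !fctE /GRing.scale /=.
by case: p v {D1 D2 Dq} => x y [a b] /=; ring.
Qed.

Lemma csmooth_cutoff c : csmooth (cutoff c).
Proof.
split=> k; last exact: (Ck_cst k 0).
exact: (@Ck_flat_comp R k 0 (quad c) (Ck_quad k c)).
Qed.

(** Chain rule with $\bar\partial(1 - c|z|^2) = -c z$ and $\chi'$ equal to [flat 2]: at index 0 the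
    second term of the derivative of [flat] disappears. *)
Lemma dbar_cutoff c z :
  dbar (cutoff c) z = (- c * flat 2 (quad c (ofC z)))%:C * z.
Proof.
rewrite /dbar /pderiv.
have E v : 'D_v (rePart (cutoff c)) (ofC z) =
    flat 2 (quad c (ofC z)) * (- c * 2 * ((ofC z).1 * v.1 + (ofC z).2 * v.2)).
  have [ex_q Dq] := is_derive_quad c (ofC z) v.
  have [_] := is_derive_flat_comp 0 ex_q.
  by rewrite Dq mul0r subr0 => <-.
have E0 v : 'D_v (imPart (cutoff c)) (ofC z) = 0 by exact: (derive_cst (0 : R) (ofC z) v).
rewrite !E !E0 {E E0}; case: z => x y /=.
set a := flat 2 _.
(* The 2 from differentiating the squares cancels the $1/2$ in $\bar\partial$. *)
rewrite (_ : _ + _ = 2 * ((- c * a)%:C * (x +i* y))).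
  by rewrite mulKf// pnatr_eq0.
apply/eqP; rewrite eq_complex /=; apply/andP; split; apply/eqP; ring.
Qed.

(** Since $(1 + 1/c)^2 > 1/c$, the disc $|z|^2 < 1/c$ fits in a square of half-side $1 + 1/c$; this
    choice avoids the square root $c^{-1/2}$. *)
Lemma quad_gt0 c p : 0 < c -> 0 < quad c p ->
  `|p.1| <= 1 + c^-1 /\ `|p.2| <= 1 + c^-1.
Proof.
move=> c0; rewrite /quad subr_gt0 mulrC -ltr_pdivlMr// div1r => h.
have ci : 0 < c^-1 by rewrite invr_gt0.
by split; rewrite ler_norml; nra.
Qed.

Lemma test_function_expr_cutoff c j : 0 < c ->
  test_function (fun z => z ^+ j * cutoff c z).
Proof.
move=> c0; have [s1 s2] := csmooth_exprM j (csmooth_cutoff c).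
split=> //.
(* The test function vanishes off the square [K], which is compact and equal to its closure, so the
   support is a closed subset of a compact set. *)
pose r := 1 + c^-1; pose K := `[- r, r] `*` `[- r, r].
have cK : compact K by apply: compact_setX; exact: segment_compact.
apply: (subclosed_compact _ cK); first exact: closed_closure.
have -> : K = closure K by apply/closure_id; apply: compact_closed => //; exact: norm_hausdorff.
apply: closureS => p /=.
rewrite mulf_eq0 negb_or => /andP[_].
rewrite /cutoff /flat; case: ifP => [q0 _|_]; last by rewrite eqxx.
by rewrite /K /= !in_itv /= -!ler_norml; exact: quad_gt0.
Qed.

End Dbar.

(** * Dominated convergence, and integrability from Gaussian weights *)

Lemma cvg_Rintegral_bounded_mul d (T : measurableType d) (R : realType)
    (mu : {measure set T -> \bar R}) (F : T -> R) (m : nat -> T -> R) (l M : R) :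
  mu.-integrable setT (EFin \o F) ->
  (forall n, measurable_fun setT (m n)) ->
  (forall n x, `|m n x| <= M) ->
  (forall x, m n x @[n --> \oo] --> l) ->
  (\int[mu]_x (F x * m n x))%R @[n --> \oo] --> (\int[mu]_x F x)%R * l.
Proof.
move=> iF mm mM ml.
have mF : measurable_fun setT F by apply/measurable_EFinP; exact: measurable_int iF.
have [|||||_ _] := @dominated_convergence _ T R mu setT measurableT
  (fun n x => (F x * m n x)%:E) (fun x => (F x * l)%:E) (fun x => (`|F x| * M)%:E).
- by move=> n; apply/measurable_EFinP; exact: measurable_funM.
- by apply/measurable_EFinP; exact: measurable_funM.
- apply: aeW => x _; apply: cvg_EFin; first by near=> n.
  by apply: cvgM; [exact: cvg_cst|exact: ml].
- exact: (integrableZr measurableT M (integrable_norm iF)).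
- by apply: aeW => x n _; rewrite lee_fin normrM ler_wpM2l.
rewrite -(RintegralZr l measurableT iF).
have il : mu.-integrable setT (fun x => (F x * l)%:E).
  exact: (integrableZr measurableT l iF).
(* Dominated convergence speaks of extended reals; finiteness of the limit brings it down to real
   integrals. *)
rewrite -[X in _ --> X]fineK; last exact: integrable_fin_num.
by move=> /fine_cvg.
Unshelve. all: by end_near. Qed.

Section Integrability.
Variable R : realType.
Let T := (measurableTypeR R * measurableTypeR R)%type.
Implicit Types (g : R[i] -> R[i]) (p : R * R) (z : R[i]).

Lemma normc_sqr z : Normc.normc z ^+ 2 = complex.Re z ^+ 2 + complex.Im z ^+ 2.
Proof. by case: z => x y /=; rewrite sqr_sqrtr// addr_ge0// sqr_ge0. Qed.

Lemma normc_ge0 z : 0 <= Normc.normc z.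
Proof. by case: z => x y; exact: sqrtr_ge0. Qed.

Lemma normc_expr z j : Normc.normc (z ^+ j) = Normc.normc z ^+ j.
Proof.
elim: j => [|j IH]; first by rewrite !expr0 Normc.normc1.
by rewrite !exprS Normc.normcM IH.
Qed.

Lemma le_Re_normc z : `|complex.Re z| <= Normc.normc z.
Proof.
rewrite -(@ler_pXn2r _ 2)// ?nnegrE ?normc_ge0//.
by rewrite normc_sqr real_normK ?num_real// lerDl sqr_ge0.
Qed.

Lemma le_Im_normc z : `|complex.Im z| <= Normc.normc z.
Proof.
rewrite -(@ler_pXn2r _ 2)// ?nnegrE ?normc_ge0//.
by rewrite normc_sqr real_normK ?num_real// lerDr sqr_ge0.
Qed.

Lemma cmeasurable_exprM g j : cmeasurable g -> cmeasurable (fun z => z ^+ j * g z).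
Proof.
move=> mg; elim: j => [|j [IH1 IH2]].
  by under eq_fun do rewrite expr0 mul1r.
split.
- rewrite (_ : rePart _ = fun p => p.1 * rePart (fun z => z ^+ j * g z) p
                           - p.2 * imPart (fun z => z ^+ j * g z) p).
    by apply: measurable_funB; apply: measurable_funM => //;
      (exact: measurable_fst || exact: measurable_snd).
  apply/funext => p; rewrite /rePart /imPart exprS -mulrA.
  by case: (_ * g _).
- rewrite (_ : imPart _ = fun p => p.1 * imPart (fun z => z ^+ j * g z) p
                           + p.2 * rePart (fun z => z ^+ j * g z) p).
    by apply: measurable_funD; apply: measurable_funM => //;
      (exact: measurable_fst || exact: measurable_snd).
  apply/funext => p; rewrite /rePart /imPart exprS -mulrA.
  by case: (_ * g _).
Qed.

Lemma measurable_sqr_norm :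
  measurable_fun [set: T] (fun p : T => (p.1 ^+ 2 + p.2 ^+ 2 : R)).
Proof.
by apply: measurable_funD; apply: measurable_funX;
  (exact: measurable_fst || exact: measurable_snd).
Qed.

Lemma integrable_expR_sqr (a : R) : 0 < a ->
  (@lebesgue_measure R).-integrable setT (fun x => (expR (- (a * x ^+ 2)))%:E).
Proof.
(* [s] is the standard deviation with $x^2 / (2 s^2) = a x^2$, so the integrand is a multiple of a
   centred normal density. *)
move=> a0; pose s := Num.sqrt (a *+ 2)^-1.
have a2 : 0 < (a *+ 2)^-1 by rewrite invr_gt0 pmulrn_lgt0.
have s0 : s != 0 by rewrite gt_eqF// sqrtr_gt0.
have E x : (expR (- (a * x ^+ 2)))%:E =
    ((normal_peak s)^-1%:E * (normal_pdf 0 s x)%:E)%E.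
  rewrite normal_pdfE// -EFinM mulKf ?gt_eqF ?normal_peak_gt0//.
  rewrite /normal_fun subr0 sqr_sqrtr ?(ltW a2)//; congr (expR _)%:E.
  by rewrite mulNr; congr (- _); rewrite mulrC; congr (_ * _); field; rewrite gt_eqF.
under eq_fun do rewrite E.
by apply: integrableZl => //; exact: integrable_normal_pdf.
Qed.

(** The Gaussian factors in the two coordinates, so its iterated integral is the square of the
    finite one-dimensional integral. *)
Lemma integrable_gauss_plane (a : R) : 0 < a ->
  (@dA R).-integrable setT
    (fun p : T => (expR (- (a * (p.1 ^+ 2 + p.2 ^+ 2))))%:E).
Proof.
move=> a0; apply/integrable12ltyP.
  apply/measurable_EFinP; apply: measurableT_comp => //.
  apply: measurableT_comp => //; apply: measurable_funM => //.
  exact: measurable_sqr_norm.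
have [mI /= Ioo] := integrableP _ _ _ (integrable_norm (integrable_expR_sqr a0)).
set I := (\int[lebesgue_measure]_x `|expR (- (a * x ^+ 2))|%:E)%E.
have {}Ioo : (I < +oo)%E.
  by apply: le_lt_trans Ioo; rewrite le_eqVlt; apply/orP; left; apply/eqP;
    apply: eq_integral => x _; rewrite normr_id.
have Ifin : I \is a fin_num by rewrite ge0_fin_numE// integral_ge0.
rewrite [ltLHS](_ : _ = I * I)%E; last first.
  have E x y : (`|expR (- (a * ((x : R) ^+ 2 + y ^+ 2)))|%:E =
      `|expR (- (a * x ^+ 2))|%:E * `|expR (- (a * y ^+ 2))|%:E)%E.
    by rewrite -EFinM -normrM -expRD mulrDr opprD.
  under eq_integral => x _.
    under eq_integral do rewrite E.
    rewrite ge0_integralZl//.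
    over.
  rewrite ge0_integralZr//.
  by rewrite integral_ge0.
by rewrite ltey_eq fin_numM.
Qed.

(** The dominating function comes from $|z^j g| \le |g|^2 e^{a|z|^2} + |z|^{2j} e^{-a|z|^2}$: the
    first term is integrable by hypothesis, the second is bounded by a Gaussian. *)
Lemma cintegrable_exprM (a : R) g j : 0 < a ->
  L2w (fun z => expR (a * Normc.normc z ^+ 2)) g ->
  cintegrable (fun z => z ^+ j * g z).
Proof.
move=> a0 [mg goo].
have a20 : 0 < a / 2 by rewrite divr_gt0.
pose N p := Normc.normc (g (toC p)) ^+ 2 * expR (a * Normc.normc (toC p) ^+ 2).
(* This constant gives $|z|^{2j} \le C e^{(a/2)|z|^2}$, by [exprn_le_expR] at $(a/2)|z|^2$. Half of
   the decay $e^{-a|z|^2}$ absorbs the power, and the other half remains in [G]. *)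
pose C := j`!%:R / (a / 2) ^+ j.
pose G p := C * expR (- (a / 2 * (p.1 ^+ 2 + p.2 ^+ 2))).
have mN : measurable_fun [set: T] N.
  rewrite /N; under eq_fun do rewrite !normc_sqr.
  apply: measurable_funM.
    by apply: measurable_funD; apply: measurable_funX; case: mg.
  apply: measurableT_comp => //; apply: measurable_funM => //.
  exact: measurable_sqr_norm.
have iN : (@dA R).-integrable setT (EFin \o N).
  apply/integrableP; split; first exact/measurable_EFinP.
  under eq_integral => p _.
    rewrite /= ger0_norm; last by rewrite mulr_ge0 ?sqr_ge0// expR_ge0.
    over.
  exact: goo.
have iG : (@dA R).-integrable setT (EFin \o G).
  rewrite (_ : EFin \o G =
    (fun p => C%:E * (expR (- (a / 2 * (p.1 ^+ 2 + p.2 ^+ 2))))%:E)%E) //.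
  by apply: integrableZl => //; exact: integrable_gauss_plane.
have dom p : Normc.normc (toC p ^+ j * g (toC p)) <= N p + G p.
  rewrite Normc.normcM normc_expr /N /G.
  rewrite -[_ ^+ 2 + _ ^+ 2](normc_sqr (toC p)).
  set n := Normc.normc (toC p); set b := Normc.normc (g _).
  have n0 : 0 <= n := normc_ge0 _.
  (* AM-GM, with the weight split evenly between the two factors. *)
  have h1 : n ^+ j * b <= b ^+ 2 * expR (a * n ^+ 2) + (n ^+ j) ^+ 2 * expR (- (a * n ^+ 2)).
    have -> : n ^+ j * b = (b * expR (a / 2 * n ^+ 2)) * (n ^+ j * expR (- (a / 2 * n ^+ 2))).
      by rewrite mulrACA expRN divff ?mulr1 1?[b * _]mulrC// gt_eqF// expR_gt0.
    have -> : b ^+ 2 * expR (a * n ^+ 2) = (b * expR (a / 2 * n ^+ 2)) ^+ 2.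
      by rewrite exprMn -expRM_natr; congr (_ * expR _); field.
    have -> : (n ^+ j) ^+ 2 * expR (- (a * n ^+ 2)) = (n ^+ j * expR (- (a / 2 * n ^+ 2))) ^+ 2.
      by rewrite [RHS]exprMn -expRM_natr; congr (_ * expR _); field.
    by nra.
  apply: (le_trans h1); rewrite lerD2l.
  have -> : a * n ^+ 2 = a / 2 * n ^+ 2 + a / 2 * n ^+ 2 by field.
  rewrite opprD expRD [leLHS]mulrA ler_wpM2r ?expR_ge0//.
  rewrite expRN ler_pdivrMr ?expR_gt0// /C mulrAC ler_pdivlMr ?exprn_gt0//.
  rewrite exprAC -exprMn [_ * (a / 2)]mulrC.
  by apply: exprn_le_expR; rewrite mulr_ge0 ?sqr_ge0// ltW.
have iNG : (@dA R).-integrable setT (EFin \o (fun p => N p + G p)).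
  rewrite (_ : EFin \o _ = (EFin \o N) \+ (EFin \o G))%E//.
  exact: integrableD.
have NG0 p : `|N p + G p| = N p + G p.
  by rewrite ger0_norm// (le_trans _ (dom p))// normc_ge0.
have [m1 m2] := cmeasurable_exprM j mg.
split; apply: (le_integrable measurableT _ _ iNG).
- exact/measurable_EFinP.
- by move=> p _; rewrite lee_fin NG0 (le_trans _ (dom p))// le_Re_normc.
- exact/measurable_EFinP.
- by move=> p _; rewrite lee_fin NG0 (le_trans _ (dom p))// le_Im_normc.
Qed.

End Integrability.

(** * Passage to the limit in complex integrals *)

Section Limit.
Variable R : realType.
Let T := (measurableTypeR R * measurableTypeR R)%type.
Implicit Types (g : R[i] -> R[i]).

(** A real multiplier acts on real and imaginary parts separately, so the real-valued convergence
    result applies to each. *)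
Lemma cvg_cintegral_bounded_mul g (m : nat -> R * R -> R) (l M : R) :
  cintegrable g -> (forall n, measurable_fun [set: T] (m n)) ->
  (forall n p, `|m n p| <= M) -> (forall p, m n p @[n --> \oo] --> l) ->
  complex.Re (cintegral (fun z => g z * (m n (ofC z))%:C)) @[n --> \oo]
    --> complex.Re (cintegral g) * l /\
  complex.Im (cintegral (fun z => g z * (m n (ofC z))%:C)) @[n --> \oo]
    --> complex.Im (cintegral g) * l.
Proof.
move=> [ig1 ig2] mm mM ml.
have E1 n : rePart (fun z => g z * (m n (ofC z))%:C) = (fun p => rePart g p * m n p).
  apply/funext => -[x y]; rewrite /rePart /=.
  by case: (g _) => a b /=; rewrite mulr0 subr0.
have E2 n : imPart (fun z => g z * (m n (ofC z))%:C) = (fun p => imPart g p * m n p).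
  apply/funext => -[x y]; rewrite /imPart /=.
  by case: (g _) => a b /=; rewrite mulr0 add0r.
split.
- rewrite (_ : (fun n => _) = (fun n => (\int[@dA R]_p (rePart g p * m n p))%R)).
    exact: (cvg_Rintegral_bounded_mul ig1 mm mM ml).
  by apply/funext => n /=; rewrite E1.
- rewrite (_ : (fun n => _) = (fun n => (\int[@dA R]_p (imPart g p * m n p))%R)).
    exact: (cvg_Rintegral_bounded_mul ig2 mm mM ml).
  by apply/funext => n /=; rewrite E2.
Qed.

Lemma measurable_flat_quad k (c : R) : measurable_fun [set: T] (fun p => flat k (quad c p)).
Proof.
apply: measurableT_comp; first exact: (continuous_measurable_fun (@continuous_flat R k)).
apply: measurable_funB => //; apply: measurable_funM => //.
exact: measurable_sqr_norm.
Qed.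

Lemma cvg_flat_quad k (p : R * R) :
  flat k (quad (harmonic n) p) @[n --> \oo] --> (flat k 1 : R).
Proof.
have cq : quad (harmonic n) p @[n --> \oo] --> (1 : R).
  rewrite -[X in _ --> X](subr0 1) -(mul0r (p.1 ^+ 2 + p.2 ^+ 2)).
  apply: cvgB; first exact: cvg_cst.
  by apply: cvgM; [exact: cvg_harmonic|exact: cvg_cst].
by apply: (cvg_comp _ _ cq); exact: continuous_flat.
Qed.

End Limit.

(** * Vanishing of the moments *)

Theorem theorem3p2 (R : realType) (f u : R[i] -> R[i]) (eps : R)
    (hf : L2w (fun z => expR (Normc.normc z ^+ 2)) f)
    (hdbar : weak_dbar u f)
    (heps : 0 < eps)
    (hu : L2w (fun z => expR (eps * Normc.normc z ^+ 2)) u) :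
  forall j : nat,
    cintegrable (fun z => z ^+ j * f z) /\
    cintegral (fun z => z ^+ j * f z) = 0.
Proof.
move=> j.
have iF : cintegrable (fun z => z ^+ j * f z).
  apply: (cintegrable_exprM j ltr01).
  by under eq_fun do rewrite mul1r.
split=> //.
(* The power is $j+1$ because $\bar\partial$ of the cutoff contributes one more factor $z$. *)
have iU : cintegrable (fun z => z ^+ j.+1 * u z) := cintegrable_exprM j.+1 heps hu.
(* $c_n = 1/(n+1)$ is positive, at most 1, and tends to 0. *)
pose c n : R := harmonic n.
have c0 n : 0 < c n by exact: harmonic_gt0.
pose mF n p : R := flat 0 (quad (c n) p).
pose mU n p : R := - c n * flat 2 (quad (c n) p).
have weak n :
    - cintegral (fun z => (z ^+ j.+1 * u z) * (mU n (ofC z))%:C) =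
    cintegral (fun z => (z ^+ j * f z) * (mF n (ofC z))%:C).
  have := hdbar _ (test_function_expr_cutoff j (c0 n)).
  rewrite (_ : (fun z => u z * _) = (fun z => z ^+ j.+1 * u z * (mU n (ofC z))%:C)).
    move=> ->; congr cintegral; apply/funext => z; rewrite /cutoff; ring.
  apply/funext => z; rewrite (dbar_exprM _ _ (csmooth_cutoff (c n))) dbar_cutoff /mU exprS; ring.
have [|||F1 F2] := @cvg_cintegral_bounded_mul R _ mF (flat 0 1) 1 iF.
- by move=> n; exact: measurable_flat_quad.
- by move=> n p; exact: (flat_norm_le 0).
- by move=> p; exact: cvg_flat_quad.
(* The bound 2 is $2!$, from [flat_norm_le] and $c_n \le 1$. The limit is 0 because the factor $c_n$
   was kept in [mU]. *)
have [|||U1 U2] := @cvg_cintegral_bounded_mul R _ mU 0 2 iU.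
- by move=> n; apply: measurable_funM => //; exact: measurable_flat_quad.
- move=> n p; rewrite normrM normrN (gtr0_norm (c0 n)) -[leRHS]mul1r.
  apply: ler_pM => //; first exact: ltW.
    by rewrite /c /harmonic /= invf_le1 ?ler1n ?ltr0n.
  exact: (flat_norm_le 2).
- move=> p; rewrite -[X in _ --> X](mul0r (flat 2 1)) -oppr0.
  by apply: cvgM; [apply: cvgN; exact: cvg_harmonic|exact: cvg_flat_quad].
have e0 : flat 0 1 != 0 :> R.
  by rewrite /flat ltr01 mulf_neq0 ?invr_neq0 ?expf_neq0 ?oner_neq0// gt_eqF// expR_gt0.
(* Uniqueness of limits, stated for real sequences so as to serve for both real and imaginary parts:
   $x e^{-1} = 0$, and the nonzero value [flat 0 1] cancels. *)
have vanish (a b : nat -> R) (x y : R) : (forall n, - b n = a n) ->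
    a n @[n --> \oo] --> x * flat 0 1 -> b n @[n --> \oo] --> y * 0 -> x = 0.
  move=> ab ax by0.
  have : a n @[n --> \oo] --> - (y * 0).
    by rewrite -(_ : (fun n => - b n) = a); [exact: cvgN|apply/funext].
  rewrite mulr0 oppr0 => a0.
  have /eqP : x * flat 0 1 = 0.
    by rewrite -(cvg_lim (@norm_hausdorff _ _) ax); exact: cvg_lim a0.
  by rewrite mulf_eq0 (negPf e0) orbF => /eqP.
have R0 : complex.Re (cintegral (fun z => z ^+ j * f z)) = 0.
  by apply: (vanish _ _ _ _ _ F1 U1) => n; rewrite -weak.
have I0 : complex.Im (cintegral (fun z => z ^+ j * f z)) = 0.
  by apply: (vanish _ _ _ _ _ F2 U2) => n; rewrite -weak.
by apply/eqP; rewrite eq_complex R0 I0 /= !eqxx.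
Qed.
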